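(* Let $\mathbf{R}$ be the variety of all ai-semirings satisfying the identity $xy\approx xz$. The lattice of subvarieties of $\mathbf{R}$ (ordered by inclusion) is a distributive lattice of order $10$. Its ten pairwise distinct elements are the trivial variety $\mathbf{T}$, $\mathsf{V}(L_2)$, $\mathsf{V}(N_2)$, $\mathsf{V}(T_2)$, $\mathsf{V}(L_2,N_2)$, $\mathsf{V}(L_2,T_2)$, $\mathsf{V}(N_2,T_2)$, $\mathsf{V}(L_2,N_2,T_2)$, $\mathsf{V}(S_{58})$ and $\mathbf{R}$, and its Hasse diagram has exactly the following covering relations (where $A\prec B$ means $B$ covers $A$): $\mathbf{T}\prec \mathsf{V}(L_2)$, $\mathbf{T}\prec\mathsf{V}(N_2)$, $\mathbf{T}\prec\mathsf{V}(T_2)$; $\mathsf{V}(L_2)\prec\mathsf{V}(L_2,N_2)$, $\mathsf{V}(L_2)\prec\mathsf{V}(L_2,T_2)$; $\mathsf{V}(N_2)\prec\mathsf{V}(L_2,N_2)$, $\mathsf{V}(N_2)\prec\mathsf{V}(N_2,T_2)$; $\mathsf{V}(T_2)\prec\mathsf{V}(L_2,T_2)$, $\mathsf{V}(T_2)\prec\mathsf{V}(N_2,T_2)$; $\mathsf{V}(L_2,N_2)\prec\mathsf{V}(L_2,N_2,T_2)$, $\mathsf{V}(L_2,T_2)\prec\mathsf{V}(L_2,N_2,T_2)$, $\mathsf{V}(N_2,T_2)\prec\mathsf{V}(L_2,N_2,T_2)$; $\mathsf{V}(L_2,T_2)\prec\mathsf{V}(S_{58})$; $\mathsf{V}(S_{58})\prec\mathbf{R}$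 and $\mathsf{V}(L_2,N_2,T_2)\prec\mathbf{R}$.
   Context: An additively idempotent semiring (ai-semiring) is an algebra $(S,+,\cdot)$ with two binary operations such that $(S,+)$ is a commutative idempotent semigroup, $(S,\cdot)$ is a semigroup, and both distributive laws $x(y+z)\approx xy+xz$ and $(x+y)z\approx xz+yz$ hold. No neutral or zero elements are part of the signature. A variety of ai-semirings is a class of ai-semirings closed under subalgebras, homomorphic images and arbitrary direct products (equivalently, defined by identities). For a class (or list) $K$ of ai-semirings, $\mathsf{V}(K)$ denotes the variety generated by $K$. $\mathbf{T}$ denotes the trivial variety (all one-element algebras). The two-element ai-semirings $L_2,N_2,T_2$ all have carrier $\{0,1\}$ and addition $x+y=\max(x,y)$. Their multiplications are: in $L_2$, $xy=x$ for all $x,y$; in $N_2$, $xy=0$ for all $x,y$; in $T_2$, $xy=1$ for all $x,y$. $S_{58}$ is the three-element ai-semiring with carrier $\{1,2,3\}$, whose addition is the join of the chain $2<1<3$ (so $1+1=1+2=1$, $2+2=2$, and $x+3=3$ for all $x$), and whose multiplication is given by $1\cdot x=3$, $2\cdot x=2$, $3\cdot x=3$ for all $x$. *)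

(* Defs.v *)
From HB Require Import structures.
From mathcomp Require Import all_boot all_order.
From mathcomp Require Import all_classical.
Set Implicit Arguments.
Unset Strict Implicit.
Unset Printing Implicit Defensive.
Import Order.TTheory.

Local Open Scope classical_set_scope.

(* The carrier is nonempty, as usual in universal algebra. The additive and
   multiplicative structures of MathComp are not used because they bundle a
   choiceType structure, which is not part of the
   signature considered here. *)
Record aiSemiring : Type := AiSemiring {
  carrier :> Type;
  sadd : carrier -> carrier -> carrier;
  smul : carrier -> carrier -> carrier;
  carrier_inh : inhabited carrier;
  saddA : associative sadd;
  saddC : commutative sadd;
  saddxx : idempotent_op sadd;
  smulA : associative smul;
  smulDr : right_distributive smul sadd;
  smulDl : left_distributive smul sadd }.

Definition is_hom (A B : aiSemiring) (f : A -> B) : Prop :=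
  {morph f : x y / sadd x y} /\ {morph f : x y / smul x y}.

Section Product.
Variables (I : Type) (B : I -> aiSemiring).

Let P : Type := forall i, B i.
Let padd (x y : P) : P := fun i => sadd (x i) (y i).
Let pmul (x y : P) : P := fun i => smul (x i) (y i).

Fact prod_inh : inhabited P.
Proof.
have [f _] : {f : P & True}; last by split.
exists (fun i => sval (cid (let: inhabits x := carrier_inh (B i) in
  ex_intro (fun=> True) x Logic.I))).
by [].
Qed.

Fact prod_addA : associative padd.
Proof. by move=> x y z; apply: functional_extensionality_dep => i; exact: saddA. Qed.
Fact prod_addC : commutative padd.
Proof. by move=> x y; apply: functional_extensionality_dep => i; exact: saddC. Qed.
Fact prod_addxx : idempotent_op padd.
Proof. by move=> x; apply: functional_extensionality_dep => i; exact: saddxx. Qed.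
Fact prod_mulA : associative pmul.
Proof. by move=> x y z; apply: functional_extensionality_dep => i; exact: smulA. Qed.
Fact prod_mulDr : right_distributive pmul padd.
Proof. by move=> x y z; apply: functional_extensionality_dep => i; exact: smulDr. Qed.
Fact prod_mulDl : left_distributive pmul padd.
Proof. by move=> x y z; apply: functional_extensionality_dep => i; exact: smulDl. Qed.

Definition prod_ais : aiSemiring :=
  AiSemiring prod_inh prod_addA prod_addC prod_addxx
    prod_mulA prod_mulDr prod_mulDl.
End Product.

(* B is (isomorphic to) a subalgebra of A when it embeds into A. *)
Definition closed_sub (V : set aiSemiring) : Prop :=
  forall (A B : aiSemiring) (f : B -> A),
    is_hom f -> injective f -> V A -> V B.

Definition closed_img (V : set aiSemiring) : Prop :=
  forall (A B : aiSemiring) (f : A -> B),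
    is_hom f -> (forall b, exists a, f a = b) -> V A -> V B.

(* The index type may be empty: a variety contains the one-element algebras. *)
Definition closed_prod (V : set aiSemiring) : Prop :=
  forall (I : Type) (B : I -> aiSemiring), (forall i, V (B i)) -> V (prod_ais B).

Definition is_variety (V : set aiSemiring) : Prop :=
  [/\ closed_sub V, closed_img V & closed_prod V].

Definition variety : Type := {V : set aiSemiring | `[< is_variety V >]}.

Definition Variety (V : set aiSemiring) (hV : is_variety V) : variety :=
  exist _ V (asboolT hV).

Lemma varietyP (V : variety) : is_variety (val V).
Proof. exact/asboolP/(valP V). Qed.

Lemma smallest_variety (K : set aiSemiring) : is_variety (smallest is_variety K).
Proof.
split.
- move=> A B f hf injf KA V /= [hV KV]; case: (hV) => S _ _.
  by apply: S hf injf _; exact: KA.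
- move=> A B f hf surjf KA V /= [hV KV]; case: (hV) => _ H _.
  by apply: H hf surjf _; exact: KA.
- move=> I B KB V /= [hV KV]; case: (hV) => _ _; apply=> i.
  exact: KB.
Qed.

Lemma setI_variety (U V : set aiSemiring) :
  is_variety U -> is_variety V -> is_variety (U `&` V).
Proof.
move=> [SU HU PU] [SV HV PV]; split.
- by move=> A B f hf inf [UA VA]; split; [exact: (SU A B f)|exact: (SV A B f)].
- by move=> A B f hf sf [UA VA]; split; [exact: (HU A B f)|exact: (HV A B f)].
- by move=> I B UV; split; [apply: PU => i; case: (UV i)|apply: PV => i; case: (UV i)].
Qed.

Definition Var (K : set aiSemiring) : variety := Variety (@smallest_variety K).

(* [variety] is ordered by inclusion: this is the order inherited from the
   order of [set aiSemiring]. *)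
HB.instance Definition _ := SubChoice.on variety.
HB.instance Definition _ := 
  [SubChoice_isSubPOrder of variety by <: with set_display].

Lemma le_varietyE (U V : variety) : (U <= V)%O = (val U `<=` val V) :> Prop.
Proof. by rewrite -subsetEset Order.le_val. Qed.

Definition vmeet (U V : variety) : variety :=
  Variety (setI_variety (varietyP U) (varietyP V)).
Definition vjoin (U V : variety) : variety := Var (val U `|` val V).

Fact vmeetP (U V W : variety) : (U <= vmeet V W)%O = (U <= V)%O && (U <= W)%O.
Proof.
apply/idP/andP.
  by rewrite !le_varietyE /= => UVW; split=> A /UVW [].
by case; rewrite !le_varietyE /= => UV UW A UA; split; [exact: UV|exact: UW].
Qed.

Fact vjoinP (U V W : variety) : (vjoin U V <= W)%O = (U <= W)%O && (V <= W)%O.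
Proof.
apply/idP/andP.
  rewrite !le_varietyE /= => UVW.
  by split=> A HA; apply: UVW; apply: sub_gen_smallest; [left|right].
case; rewrite !le_varietyE /= => UW VW.
by apply: smallest_sub; [exact: varietyP|move=> A [/UW|/VW]].
Qed.

HB.instance Definition _ :=
  Order.POrder_MeetJoin_isLattice.Build _ variety vmeetP vjoinP.

Definition below (W : variety) : pred variety := [pred V | (V <= W)%O].

Definition subvariety (W : variety) : Type := {V : variety | below W V}.

Fact belowI (W : variety) : meet_closed (below W).
Proof. by move=> U V; rewrite !unfold_in /= => UW _; exact: le_trans (leIl _ _) UW. Qed.
Fact belowU (W : variety) : join_closed (below W).
Proof. by move=> U V; rewrite !unfold_in /= leUx => -> ->. Qed.

HB.instance Definition _ W := SubChoice.on (subvariety W).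
HB.instance Definition _ W :=
  Order.SubChoice_isSubLattice.Build _ _ _ set_display (subvariety W)
    (@belowI W) (@belowU W).

Definition covers {d} {T : porderType d} (y x : T) : Prop :=
  (x < y)%O /\ forall z : T, ~~ (x < z < y)%O.

Definition R_class : set aiSemiring :=
  [set A : aiSemiring | forall x y z : A, smul x y = smul x z].

Lemma R_class_variety : is_variety R_class.
Proof.
split.
- by move=> A B f [_ fM] injf RA x y z; apply: injf; rewrite !fM; exact: RA.
- move=> A B f [_ fM] surjf RA x y z.
  case: (surjf x) (surjf y) (surjf z) => a <- [b <-] [c <-].
  by rewrite -!fM; congr f; exact: RA.
- by move=> I B RB x y z; apply: functional_extensionality_dep => i; exact: RB.
Qed.

Definition R : variety := Variety R_class_variety.

(* One-element algebras: carriers are nonempty. *)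
Definition T_class : set aiSemiring := [set A : aiSemiring | forall x y : A, x = y].

Lemma T_class_variety : is_variety T_class.
Proof.
split.
- by move=> A B f _ injf TA x y; apply: injf; exact: TA.
- move=> A B f _ surjf TA x y.
  by case: (surjf x) (surjf y) => a <- [b <-]; congr f; exact: TA.
- by move=> I B TB x y; apply: functional_extensionality_dep => i; exact: TB.
Qed.

(* The two-element algebras have carrier bool, with false = 0 and true = 1;
   max is orb. *)
Section TwoElements.
Variable m : bool -> bool -> bool.
Hypotheses (mA : associative m) (mDr : right_distributive m orb)
  (mDl : left_distributive m orb).
Definition ais2 : aiSemiring :=
  AiSemiring (inhabits true) orbA orbC orbb mA mDr mDl.
End TwoElements.

Definition L2_mul (x _ : bool) := x.
Definition N2_mul (_ _ : bool) := false.
Definition T2_mul (_ _ : bool) := true.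

Fact L2_mulA : associative L2_mul. Proof. by []. Qed.
Fact L2_mulDr : right_distributive L2_mul orb. Proof. by do 3!case. Qed.
Fact L2_mulDl : left_distributive L2_mul orb. Proof. by []. Qed.
Definition L2 : aiSemiring := ais2 L2_mulA L2_mulDr L2_mulDl.

Fact N2_mulA : associative N2_mul. Proof. by []. Qed.
Fact N2_mulDr : right_distributive N2_mul orb. Proof. by []. Qed.
Fact N2_mulDl : left_distributive N2_mul orb. Proof. by []. Qed.
Definition N2 : aiSemiring := ais2 N2_mulA N2_mulDr N2_mulDl.

Fact T2_mulA : associative T2_mul. Proof. by []. Qed.
Fact T2_mulDr : right_distributive T2_mul orb. Proof. by []. Qed.
Fact T2_mulDl : left_distributive T2_mul orb. Proof. by []. Qed.
Definition T2 : aiSemiring := ais2 T2_mulA T2_mulDr T2_mulDl.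

Inductive three : Set := e1 | e2 | e3.

(* Join of the chain e2 < e1 < e3. *)
Definition S58_add (x y : three) : three :=
  match x, y with
  | e3, _ | _, e3 => e3
  | e1, _ | _, e1 => e1
  | e2, e2 => e2
  end.
Definition S58_mul (x _ : three) : three := if x is e2 then e2 else e3.

Fact S58_addA : associative S58_add. Proof. by do 3!case. Qed.
Fact S58_addC : commutative S58_add. Proof. by do 2!case. Qed.
Fact S58_addxx : idempotent_op S58_add. Proof. by case. Qed.
Fact S58_mulA : associative S58_mul. Proof. by case. Qed.
Fact S58_mulDr : right_distributive S58_mul S58_add. Proof. by do 3!case. Qed.
Fact S58_mulDl : left_distributive S58_mul S58_add. Proof. by do 3!case. Qed.
Definition S58 : aiSemiring :=
  AiSemiring (inhabits e1) S58_addA S58_addC S58_addxx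
    S58_mulA S58_mulDr S58_mulDl.

(* The variety generated by a class K contained in R, as a subvariety of R. *)
Lemma below_Var (K : set aiSemiring) : K `<=` R_class -> below R (Var K).
Proof.
move=> KR; rewrite /below /= le_varietyE.
by apply: smallest_sub => //; exact: R_class_variety.
Qed.

Definition VarR (K : set aiSemiring) (KR : K `<=` R_class) : subvariety R :=
  exist _ (Var K) (below_Var KR).

Fact T_below : below R (Variety T_class_variety).
Proof. by rewrite /below /= le_varietyE => A TA x y z; exact: TA. Qed.
Fact L2_R : [set L2] `<=` R_class. Proof. by move=> _ ->. Qed.
Fact N2_R : [set N2] `<=` R_class. Proof. by move=> _ ->. Qed.
Fact T2_R : [set T2] `<=` R_class. Proof. by move=> _ ->. Qed.
Fact L2N2_R : [set L2; N2] `<=` R_class. Proof. by move=> _ [] ->. Qed.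
Fact L2T2_R : [set L2; T2] `<=` R_class. Proof. by move=> _ [] ->. Qed.
Fact N2T2_R : [set N2; T2] `<=` R_class. Proof. by move=> _ [] ->. Qed.
Fact L2N2T2_R : [set L2; N2; T2] `<=` R_class. Proof. by move=> _ [[]|] ->. Qed.
Fact S58_R : [set S58] `<=` R_class. Proof. by move=> _ ->. Qed.

Definition V_T : subvariety R := exist _ (Variety T_class_variety) T_below.
Definition V_L2 : subvariety R := VarR L2_R.
Definition V_N2 : subvariety R := VarR N2_R.
Definition V_T2 : subvariety R := VarR T2_R.
Definition V_L2N2 : subvariety R := VarR L2N2_R.
Definition V_L2T2 : subvariety R := VarR L2T2_R.
Definition V_N2T2 : subvariety R := VarR N2T2_R.
Definition V_L2N2T2 : subvariety R := VarR L2N2T2_R.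
Definition V_S58 : subvariety R := VarR S58_R.
Definition V_R : subvariety R := exist _ R (lexx R).

(* Main.v *)
(* In an algebra of R the product xy depends only on x, so R consists of the
   semilattices with an idempotent endomorphism p(x) = xx. For fixed b the map
   x |-> ([x not <= b], [p(x) not <= b]) is a homomorphism into the four-element
   algebra Q on {0,1}^2 with p(u,v) = (v,v), and these maps separate points; so
   a subvariety of R is determined by the subalgebras of Q that it contains. Up
   to isomorphism the nontrivial ones are L2, N2, T2, S58, a three-element chain
   M and Q itself. M is a quotient of L2 x N2 and Q of S58 x N2, so only the
   membership of L2, N2, T2 and S58 matters; S58 forces L2 and T2, which leaves
   ten possibilities. Non-membership is witnessed by the identities
   xx = yy (fails in L2), x + xx = xx (fails in N2), x + xx = x (fails in T2)
   and x + xx + yy = x + yy (fails in S58). *)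
Require Import Defs.
From mathcomp Require Import all_boot all_order.
From mathcomp Require Import all_classical.

Set Implicit Arguments.
Unset Strict Implicit.
Unset Printing Implicit Defensive.
Import Order.TTheory.
Local Open Scope classical_set_scope.

(** * Varieties defined by identities in two variables *)

(* Naturality replaces a syntax of terms in two variables. *)
Definition natural_op (t : forall A : aiSemiring, A -> A -> A) : Prop :=
  forall (A B : aiSemiring) (f : A -> B), is_hom f ->
    {morph f : x y / t A x y >-> t B x y}.

Definition identity_class (t u : forall A : aiSemiring, A -> A -> A) :
    set aiSemiring :=
  [set A : aiSemiring | forall x y : A, t A x y = u A x y].

Lemma is_hom_proj I (B : I -> aiSemiring) i :
  is_hom (fun x : prod_ais B => x i).
Proof. by []. Qed.

Lemma identity_class_variety t u :
  natural_op t -> natural_op u -> is_variety (identity_class t u).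
Proof.
move=> tN uN; split.
- by move=> A B f hf injf tu x y; apply: injf;
    rewrite (tN _ _ f) // (uN _ _ f) //; exact: tu.
- move=> A B f hf surjf tu x y; case: (surjf x) (surjf y) => a <- [b <-].
  by rewrite -(tN _ _ f) // -(uN _ _ f) // tu.
- move=> I B tu x y; apply: functional_extensionality_dep => i.
  rewrite (tN _ _ _ (is_hom_proj B i)) (uN _ _ _ (is_hom_proj B i)).
  exact: tu.
Qed.

(** The four classes contain, in order, [N2] and [T2]; [L2], [T2] and [S58]; [L2] and [N2]; [L2],
    [N2] and [T2]. This settles every exclusion from the nontrivial generated varieties. *)
Definition const_square_class :=
  identity_class (fun A x y => smul x x) (fun A x y => smul y y).
Definition le_square_class :=
  identity_class (fun A x y => sadd x (smul x x)) (fun A x y => smul x x).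
Definition ge_square_class :=
  identity_class (fun A x y => sadd x (smul x x)) (fun A x y => x).
Definition absorb_square_class :=
  identity_class (fun A x y => sadd (sadd x (smul x x)) (smul y y))
                 (fun A x y => sadd x (smul y y)).

Lemma const_square_variety : is_variety const_square_class.
Proof.
by apply: identity_class_variety => A B f [fD fM] x y; rewrite ?(fD, fM).
Qed.
Lemma le_square_variety : is_variety le_square_class.
Proof.
by apply: identity_class_variety => A B f [fD fM] x y; rewrite ?(fD, fM).
Qed.
Lemma ge_square_variety : is_variety ge_square_class.
Proof.
by apply: identity_class_variety => A B f [fD fM] x y; rewrite ?(fD, fM).
Qed.
Lemma absorb_square_variety : is_variety absorb_square_class.
Proof.
by apply: identity_class_variety => A B f [fD fM] x y; rewrite ?(fD, fM).
Qed.

(** * Images of binary products and of homomorphisms *)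

Lemma variety_prod2_img (V : set aiSemiring) (A B C : aiSemiring)
    (f : A -> B -> C) :
  is_variety V -> V A -> V B ->
  (forall a a' b b', f (sadd a a') (sadd b b') = sadd (f a b) (f a' b')) ->
  (forall a a' b b', f (smul a a') (smul b b') = smul (f a b) (f a' b')) ->
  (forall c, exists a b, f a b = c) -> V C.
Proof.
move=> [_ imgV prodV] VA VB fD fM surjf.
pose D i := if i then A else B.
apply: (imgV (prod_ais D) C (fun x => f (x true) (x false))).
- by split=> x y /=; [exact: fD|exact: fM].
- move=> c; have [a [b <-]] := surjf c.
  by exists (fun i : bool => if i return D i then a else b).
- by apply: prodV; case.
Qed.

(** An embedding [e] with the same range as [f] stands for the image of [f], so no algebra has to be
    built on a subset of [C]. *)
Lemma factor_through_image (A B C : aiSemiring) (f : A -> C) (e : B -> C) :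
  is_hom f -> is_hom e -> injective e ->
  (forall c, (exists a, f a = c) <-> (exists b, e b = c)) ->
  exists g : A -> B, [/\ is_hom g, forall b, exists a, g a = b &
                         forall a, e (g a) = f a].
Proof.
move=> [fD fM] [eD eM] injE im.
have [g gE] := choice (fun a => (im (f a)).1 (ex_intro _ a erefl)).
exists g; split=> //.
  by split=> x y; apply: injE; rewrite ?eD ?eM !gE ?fD ?fM.
move=> b; have [a fa] := (im (e b)).2 (ex_intro _ b erefl).
by exists a; apply: injE; rewrite gE.
Qed.

(** * The four-element algebra [Q] and its subalgebras *)

(* A pair (u, v) stands for (x not <= b, p(x) not <= b), so p(u, v) = (v, v). *)
Definition Q_add (x y : bool * bool) := (x.1 || y.1, x.2 || y.2).
Definition Q_mul (x _ : bool * bool) := (x.2, x.2).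
Fact Q_addA : associative Q_add. Proof. by do 3!case=> [] [] []. Qed.
Fact Q_addC : commutative Q_add. Proof. by do 2!case=> [] [] []. Qed.
Fact Q_addxx : idempotent_op Q_add. Proof. by case=> [] [] []. Qed.
Fact Q_mulA : associative Q_mul. Proof. by []. Qed.
Fact Q_mulDr : right_distributive Q_mul Q_add.
Proof. by do 3!case=> [] [] []. Qed.
Fact Q_mulDl : left_distributive Q_mul Q_add.
Proof. by do 3!case=> [] [] []. Qed.
Definition Q : aiSemiring :=
  AiSemiring (inhabits (true, true)) Q_addA Q_addC Q_addxx
    Q_mulA Q_mulDr Q_mulDl.

(** On the same chain as [S58], the middle element now squares to the bottom instead of the top. *)
Definition M_mul (x _ : three) : three := if x is e3 then e3 else e2.
Fact M_mulA : associative M_mul. Proof. by case. Qed.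
Fact M_mulDr : right_distributive M_mul S58_add. Proof. by do 3!case. Qed.
Fact M_mulDl : left_distributive M_mul S58_add. Proof. by do 3!case. Qed.
Definition M : aiSemiring :=
  AiSemiring (inhabits e1) S58_addA S58_addC S58_addxx M_mulA M_mulDr M_mulDl.

(** [L2] becomes the diagonal, [N2] and [T2] the fibres of the second coordinate; [M] omits (false,
    true) and [S58] omits (true, false). *)
Definition L2_Q (x : L2) : Q := (x, x).
Definition N2_Q (x : N2) : Q := (x, false).
Definition T2_Q (x : T2) : Q := (x, true).
Definition M_Q (x : M) : Q :=
  match x with
  | e2 => (false, false) | e1 => (true, false) | e3 => (true, true)
  end.
Definition S58_Q (x : S58) : Q :=
  match x with
  | e2 => (false, false) | e1 => (false, true) | e3 => (true, true)
  end.

Lemma L2_Q_hom : is_hom L2_Q. Proof. by split; do 2!case. Qed.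
Lemma N2_Q_hom : is_hom N2_Q. Proof. by split; do 2!case. Qed.
Lemma T2_Q_hom : is_hom T2_Q. Proof. by split; do 2!case. Qed.
Lemma M_Q_hom : is_hom M_Q. Proof. by split; do 2!case. Qed.
Lemma S58_Q_hom : is_hom S58_Q. Proof. by split; do 2!case. Qed.
Lemma L2_Q_inj : injective L2_Q. Proof. by do 2!case. Qed.
Lemma N2_Q_inj : injective N2_Q. Proof. by do 2!case. Qed.
Lemma T2_Q_inj : injective T2_Q. Proof. by do 2!case. Qed.
Lemma M_Q_inj : injective M_Q. Proof. by do 2!case. Qed.
Lemma S58_Q_inj : injective S58_Q. Proof. by do 2!case. Qed.

(** * Membership of algebras in a variety *)

Section Membership.
Variables (V : set aiSemiring) (hV : is_variety V).

Lemma variety_embed (A B : aiSemiring) (f : B -> A) :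
  is_hom f -> injective f -> V A -> V B.
Proof. by have [subV _ _] := hV; exact: subV. Qed.

Lemma S58_mem_L2 : V S58 -> V L2.
Proof.
apply: (@variety_embed S58 L2 (fun x : bool => if x then e3 else e2)).
  by split; do 2!case.
by do 2!case.
Qed.

Lemma S58_mem_T2 : V S58 -> V T2.
Proof.
apply: (@variety_embed S58 T2 (fun x : bool => if x then e3 else e1)).
  by split; do 2!case.
by do 2!case.
Qed.

Lemma M_mem : V M <-> V L2 /\ V N2.
Proof.
split=> [VM|[VL VN]].
  split.
    apply: (@variety_embed M L2 (fun x : bool => if x then e3 else e2)) VM.
      by split; do 2!case.
    by do 2!case.
  apply: (@variety_embed M N2 (fun x : bool => if x then e1 else e2)) VM.
    by split; do 2!case.
  by do 2!case.
(* The quotient of L2 x N2 identifies the two pairs with first coordinate true. *)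
apply: (variety_prod2_img (f := fun (x : L2) (y : N2) =>
  (if x then e3 else if y then e1 else e2) : M)) => //; try by do 4!case.
by case; [exists false, true|exists false, false|exists true, true].
Qed.

Lemma Q_mem : V Q <-> V S58 /\ V N2.
Proof.
split=> [VQ|[VS VN]].
  split; first exact: variety_embed S58_Q_hom S58_Q_inj VQ.
  exact: variety_embed N2_Q_hom N2_Q_inj VQ.
(* Adding the two embeddings into [Q] is onto, since [N2] supplies (true, false), the pair missing
   from [S58]. *)
apply: (variety_prod2_img (f := fun x y => sadd (S58_Q x) (N2_Q y))) => //.
- by do 4!case.
- by do 4!case.
by case=> [[] []];
  [exists e3, true|exists e2, true|exists e1, false|exists e2, false].
Qed.

(** The maps chosen for all b embed [A] into a product: if x and y have equal images, b = x gives y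
    <= x and b = y gives x <= y. *)
Lemma variety_separated (A : aiSemiring) :
  (forall b : A, exists B : aiSemiring, V B /\ exists g : A -> B, is_hom g /\
     forall x y, g x = g y -> sadd x b = b -> sadd y b = b) -> V A.
Proof.
move=> sepA.
pose sep b (Bg : {B : aiSemiring & A -> B}) := V (projT1 Bg) /\
  is_hom (projT2 Bg) /\
  forall x y, projT2 Bg x = projT2 Bg y -> sadd x b = b -> sadd y b = b.
have /choice[Bg BgP] : forall b, exists Bg, sep b Bg.
  by move=> b; have [B [VB [g gP]]] := sepA b; exists (existT _ B g).
have [_ _ prodV] := hV.
apply: (@variety_embed (prod_ais (fun b => projT1 (Bg b))) A
          (fun x b => projT2 (Bg b) x)).
- by split=> x y; apply: functional_extensionality_dep => b;
    have [_ [[gD gM] _]] := BgP b; [exact: gD|exact: gM].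
- move=> x y xy.
  have g_xy b : projT2 (Bg b) x = projT2 (Bg b) y
    by rewrite (congr1 (@^~ b) xy).
  have <- : sadd y x = x.
    by have [_ [_ /(_ _ _ (g_xy x))]] := BgP x; apply; exact: saddxx.
  rewrite saddC; have [_ [_ /(_ _ _ (esym (g_xy y)))]] := BgP y.
  by apply; exact: saddxx.
- by apply: prodV => b; have [] := BgP b.
Qed.
End Membership.

(** * Comparison of subvarieties through the maps into [Q] *)

Lemma saddx_le (A : aiSemiring) (x y b : A) :
  sadd (sadd x y) b = b <-> sadd x b = b /\ sadd y b = b.
Proof.
split=> [xyb|[xb yb]]; last by rewrite -saddA yb.
split; rewrite -{1}xyb saddA; last by rewrite (saddC y) -(saddA x) saddxx.
by rewrite saddA saddxx.
Qed.

Definition ideal_Q (A : aiSemiring) (b x : A) : Q :=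
  (~~ `[< sadd x b = b >], ~~ `[< sadd (smul x x) b = b >]).

(** A join lies below b exactly when both terms do, and in R the map p is additive and idempotent
    with xy = p(x). *)
Lemma ideal_Q_hom (A : aiSemiring) (b : A) : R_class A -> is_hom (ideal_Q b).
Proof.
move=> RA.
have pD (x y : A) : smul (sadd x y) (sadd x y) = sadd (smul x x) (smul y y).
  by rewrite smulDl (RA x _ x) (RA y _ y).
have pp (x y : A) : smul (smul x y) (smul x y) = smul x y.
  by rewrite -smulA; exact: RA.
split=> x y; rewrite /ideal_Q /= /Q_add /Q_mul /=.
  by rewrite pD -!negb_and; congr (~~ _, ~~ _);
    apply/asboolP/andP => [/saddx_le[]|[/asboolP ? /asboolP ?]];
    [split; exact/asboolP|exact/saddx_le|split; exact/asboolP|exact/saddx_le].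
by rewrite pp (RA x y x).
Qed.

(** For each b the image of [ideal_Q b] is isomorphic to an algebra of [U]. The pairs it contains
    identify it, and the hypotheses then place it in [V]. *)
Lemma sub_varietyP (U V : set aiSemiring) :
  is_variety U -> is_variety V -> U `<=` R_class ->
  (U L2 -> V L2) -> (U N2 -> V N2) -> (U T2 -> V T2) -> (U S58 -> V S58) ->
  U `<=` V.
Proof.
move=> hU hV UR UVL UVN UVT UVS A UA; apply: (variety_separated hV) => b.
have fh := ideal_Q_hom b (UR _ UA).
set f := ideal_Q b in fh; have [fD fM] := fh.
pose im c := exists a, f a = c.
have imD c d : im c -> im d -> im (sadd c d).
  by move=> [x <-] [y <-]; exists (sadd x y); rewrite fD.
have imM c d : im c -> im d -> im (smul c d).
  by move=> [x <-] [y <-]; exists (smul x y); rewrite fM.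
have sepb (B : aiSemiring) (e : B -> Q) :
    is_hom e -> injective e -> (U B -> V B) ->
    (forall c, im c <-> exists y, e y = c) ->
    exists B : aiSemiring, V B /\ exists g : A -> B, is_hom g /\
      forall x y, g x = g y -> sadd x b = b -> sadd y b = b.
  move=> eh injE UVB imE.
  have [g [gh gsurj gE]] := factor_through_image fh eh injE imE.
  exists B; split.
    by apply: UVB; have [_ imgU _] := hU; exact: imgU gh gsurj UA.
  exists g; split=> // x y gxy /asboolP xb; apply/asboolP/negbFE.
  have : (f x).1 = (f y).1 by rewrite -!gE gxy.
  by rewrite /f /ideal_Q /= xb => <-.
(* Since b <= b, the image of b has first coordinate false. *)
have im0 : im (false, false) \/ im (false, true).
  have : im (f b) by exists b.
  by rewrite /f /ideal_Q saddxx asboolT //=; case: asboolP; [left|right].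
have [im01|nim01] := pselect (im (false, true));
  have [im10|nim10] := pselect (im (true, false)).
(* These two pairs generate [Q]: their sum is (true, true), and (true, false) squares to (false,
   false). *)
- apply: (sepb Q id) => //.
    by move=> /(Q_mem hU)[/UVS ? /UVN ?]; apply/(Q_mem hV).
  move=> c; split=> [_|_]; first by exists c.
  case: c => [[] []] //; first exact: imD im01 im10.
  exact: (imM _ _ im10 im10).
- have im11 := imM _ _ im01 im01.
  have [im00|nim00] := pselect (im (false, false)).
    apply: (sepb S58 S58_Q S58_Q_hom S58_Q_inj) => // c.
    split=> [|[y <-]]; last by case: y.
    by case: c => [[] []] // _; [exists e3|exists e1|exists e2].
  apply: (sepb T2 T2_Q T2_Q_hom T2_Q_inj) => // c.
  split=> [|[y <-]]; last by case: y.
  by case: c => [[] []] // _; [exists true|exists false].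
- have im00 := imM _ _ im10 im10.
  have [im11|nim11] := pselect (im (true, true)).
    apply: (sepb M M_Q M_Q_hom M_Q_inj).
      by move=> /(M_mem hU)[/UVL ? /UVN ?]; apply/(M_mem hV).
    move=> c; split=> [|[y <-]]; last by case: y.
    by case: c => [[] []] // _; [exists e3|exists e1|exists e2].
  apply: (sepb N2 N2_Q N2_Q_hom N2_Q_inj) => // c.
  split=> [|[y <-]]; last by case: y.
  by case: c => [[] []] // _; [exists true|exists false].
- have im00 : im (false, false) by case: im0.
  have [im11|nim11] := pselect (im (true, true)).
    apply: (sepb L2 L2_Q L2_Q_hom L2_Q_inj) => // c.
    split=> [|[y <-]]; last by case: y.
    by case: c => [[] []] // _; [exists true|exists false].
  (* Only (false, false) remains, so b is the top of [A] and a map to the empty product, a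
     one-element algebra, suffices. *)
  have allb y : sadd y b = b.
    apply/asboolP/negbFE; have : im (f y) by exists y.
    rewrite {1}/f /ideal_Q; case: (~~ _) => //; case: (~~ _) => //.
  exists (prod_ais (False_rect aiSemiring)); split.
    by have [_ _ prodV] := hV; apply: prodV; case.
  exists (fun _ i => False_rect (False_rect aiSemiring i) i).
  by split=> //; split=> x y; apply: functional_extensionality_dep; case.
Qed.

(** * Encoding subvarieties by four membership bits *)

Definition code (V : subvariety R) : bool * bool * bool * bool :=
  let mem (A : aiSemiring) := `[< val (val V) A >] in
  (mem L2, mem N2, mem T2, mem S58).

Definition le_code (c d : bool * bool * bool * bool) : bool :=
  [&& c.1.1.1 ==> d.1.1.1, c.1.1.2 ==> d.1.1.2, c.1.2 ==> d.1.2 & c.2 ==> d.2].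

Lemma le_subvarietyE (U V : subvariety R) :
  (U <= V)%O <-> val (val U) `<=` val (val V).
Proof. by rewrite -Order.le_val le_varietyE. Qed.

(** The implication from codes to inclusion is [sub_varietyP]; order questions thereby become
    Boolean computations. *)
Lemma le_codeE (U V : subvariety R) : (U <= V)%O = le_code (code U) (code V).
Proof.
apply/idP/idP => [/le_subvarietyE UV|].
  by apply/and4P; split; apply/implyP => /asboolP /UV /asboolP.
move=> /and4P[/implyP UVL /implyP UVN /implyP UVT /implyP UVS].
apply/le_subvarietyE; apply: sub_varietyP; try exact: varietyP.
- by have /= := valP U; rewrite le_varietyE.
- by move=> /asboolP/UVL/asboolP.
- by move=> /asboolP/UVN/asboolP.
- by move=> /asboolP/UVT/asboolP.
- by move=> /asboolP/UVS/asboolP.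
Qed.

Lemma code_inj : injective code.
Proof.
move=> U V UV; apply: le_anti; rewrite !le_codeE UV.
by case: (code V) => [[[[] []] []] []].
Qed.

(** * Codes of the ten subvarieties *)

Lemma Var_mem (K : set aiSemiring) (A : aiSemiring) :
  K A -> `[< val (Var K) A >].
Proof. by move=> KA; apply/asboolP; exact: sub_gen_smallest. Qed.

Lemma Var_notin (K C : set aiSemiring) (A : aiSemiring) :
  is_variety C -> K `<=` C -> ~ C A -> `[< val (Var K) A >] = false.
Proof. by move=> hC KC nCA; apply/asboolPn => /(smallest_sub hC KC). Qed.

Lemma const_square_L2 : ~ const_square_class L2.
Proof. by move/(_ true false). Qed.
Lemma le_square_N2 : ~ le_square_class N2.
Proof. by move/(_ true true). Qed.
Lemma ge_square_T2 : ~ ge_square_class T2.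
Proof. by move/(_ false false). Qed.
Lemma absorb_square_S58 : ~ absorb_square_class S58.
Proof. by move/(_ e1 e2). Qed.

Lemma code_V_T : code V_T = (false, false, false, false).
Proof.
have nT (A : aiSemiring) (x y : A) : x <> y -> `[< T_class A >] = false.
  by move=> xy; apply/asboolPn => /(_ x y).
by congr (_, _, _, _); [exact: (nT L2 true false)|exact: (nT N2 true false)|
  exact: (nT T2 true false)|exact: (nT S58 e1 e2)].
Qed.

Lemma code_V_R : code V_R = (true, true, true, true).
Proof. by rewrite /code /= !asboolT. Qed.

(** An identity is checked on the generators by evaluating all cases. *)
Ltac Var_out hC nC :=
  by apply: (Var_notin hC) nC => A; rewrite /=; intuition; subst; do 2!case.

Ltac solve_code :=
  congr (_, _, _, _);
  first [ by apply: Var_mem; rewrite /=; tauto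
        | Var_out const_square_variety const_square_L2
        | Var_out le_square_variety le_square_N2
        | Var_out ge_square_variety ge_square_T2
        | Var_out absorb_square_variety absorb_square_S58 ].

Lemma code_V_L2 : code V_L2 = (true, false, false, false).
Proof. solve_code. Qed.
Lemma code_V_N2 : code V_N2 = (false, true, false, false).
Proof. solve_code. Qed.
Lemma code_V_T2 : code V_T2 = (false, false, true, false).
Proof. solve_code. Qed.
Lemma code_V_L2N2 : code V_L2N2 = (true, true, false, false).
Proof. solve_code. Qed.
Lemma code_V_L2T2 : code V_L2T2 = (true, false, true, false).
Proof. solve_code. Qed.
Lemma code_V_N2T2 : code V_N2T2 = (false, true, true, false).
Proof. solve_code. Qed.
Lemma code_V_L2N2T2 : code V_L2N2T2 = (true, true, true, false).
Proof. solve_code. Qed.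
Lemma code_V_S58 : code V_S58 = (true, false, true, true).
Proof.
(* [L2] and [T2] are not generators here; they enter as subalgebras of [S58]. *)
have S58in : val (val V_S58) S58 by apply/asboolP; exact: Var_mem.
rewrite /code; congr (_, _, _, _).
- by apply/asboolP; exact: S58_mem_L2 (varietyP _) S58in.
- by apply: (Var_notin le_square_variety) le_square_N2 => _ ->; do 2!case.
- by apply/asboolP; exact: S58_mem_T2 (varietyP _) S58in.
- exact/asboolP.
Qed.

Definition codeE :=
  (code_V_T, code_V_L2, code_V_N2, code_V_T2, code_V_L2N2, code_V_L2T2,
  code_V_N2T2, code_V_L2N2T2, code_V_S58, code_V_R).

Definition subvarieties : seq (subvariety R) :=
  [:: V_T; V_L2; V_N2; V_T2; V_L2N2; V_L2T2; V_N2T2; V_L2N2T2; V_S58; V_R].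

Definition codes : seq (bool * bool * bool * bool) :=
  [:: (false, false, false, false); (true, false, false, false);
      (false, true, false, false); (false, false, true, false);
      (true, true, false, false); (true, false, true, false);
      (false, true, true, false); (true, true, true, false);
      (true, false, true, true); (true, true, true, true)].

Lemma map_code : map code subvarieties = codes.
Proof. by rewrite /= !codeE. Qed.

(** The sole constraint is that [S58] forces [L2] and [T2]; it excludes six of the sixteen
    quadruples. *)
Lemma mem_codes c : (c \in codes) = (c.2 ==> c.1.1.1 && c.1.2).
Proof. by case: c => [[[[] []] []] []]. Qed.

Lemma code_mem V : code V \in codes.
Proof.
rewrite mem_codes; apply/implyP => /asboolP VS; apply/andP.
by split; apply/asboolP; [apply: S58_mem_L2|apply: S58_mem_T2] => //;
  exact: varietyP.
Qed.

Lemma code_surj c : c \in codes -> exists V, code V = c.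
Proof.
by rewrite -map_code => /mapP[V _ ->]; exists V.
Qed.

Lemma subvarieties_all V : V \in subvarieties.
Proof. by rewrite -(mem_map code_inj) map_code code_mem. Qed.

Lemma subvarieties_uniq : uniq subvarieties.
Proof. by apply: (map_uniq (f := code)); rewrite map_code. Qed.

(** * Lattice operations and covers on codes *)

Definition meet_code (c d : bool * bool * bool * bool) :=
  (c.1.1.1 && d.1.1.1, c.1.1.2 && d.1.1.2, c.1.2 && d.1.2, c.2 && d.2).
Definition join_code (c d : bool * bool * bool * bool) :=
  (c.1.1.1 || d.1.1.1, c.1.1.2 || d.1.1.2, c.1.2 || d.1.2, c.2 || d.2).

Lemma le_code_anti c d : le_code c d -> le_code d c -> c = d.
Proof. by move: c d => [[[[] []] []] []] [[[[] []] []] []]. Qed.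

Lemma le_code_refl c : le_code c c.
Proof. by case: c => [[[[] []] []] []]. Qed.

Lemma le_code_meet e c d :
  le_code e (meet_code c d) = le_code e c && le_code e d.
Proof.
have implyD a b1 b2 : (a ==> b1 && b2) = (a ==> b1) && (a ==> b2).
  by rewrite !implybE orb_andr.
(* The eight implications alternate between [c] and [d]; [AC] gathers the odd positions, then the
   even ones. *)
by rewrite /le_code /= !implyD (AC (2*(2*(2*2))) ((1*(3*(5*7)))*(2*(4*(6*8))))).
Qed.

Lemma le_code_join c d e :
  le_code (join_code c d) e = le_code c e && le_code d e.
Proof.
have implyD a1 a2 b : (a1 || a2 ==> b) = (a1 ==> b) && (a2 ==> b).
  by rewrite !implybE negb_or orb_andl.
by rewrite /le_code /= !implyD (AC (2*(2*(2*2))) ((1*(3*(5*7)))*(2*(4*(6*8))))).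
Qed.

Lemma meet_code_mem c d : c \in codes -> d \in codes -> meet_code c d \in codes.
Proof. by move: c d => [[[[] []] []] []] [[[[] []] []] []]. Qed.

Lemma join_code_mem c d : c \in codes -> d \in codes -> join_code c d \in codes.
Proof. by move: c d => [[[[] []] []] []] [[[[] []] []] []]. Qed.

Lemma code_meet (U V : subvariety R) :
  code (U `&` V)%O = meet_code (code U) (code V).
Proof.
have [W WE] := code_surj (meet_code_mem (code_mem U) (code_mem V)).
apply: le_code_anti; first by rewrite le_code_meet -!le_codeE leIl leIr.
by rewrite -WE -le_codeE lexI !le_codeE WE -le_code_meet le_code_refl.
Qed.

(** Each of the four algebras is thus join-prime: it lies in a join only if it lies in one of the
    two. The reason is that some subvariety [W] realizes the componentwise join. *)
Lemma code_join (U V : subvariety R) :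
  code (U `|` V)%O = join_code (code U) (code V).
Proof.
have [W WE] := code_surj (join_code_mem (code_mem U) (code_mem V)).
apply: le_code_anti; last by rewrite le_code_join -!le_codeE leUl leUr.
by rewrite -WE -le_codeE leUx !le_codeE WE -le_code_join le_code_refl.
Qed.

Definition lt_code c d := (d != c) && le_code c d.

Definition covers_code d c :=
  lt_code c d && all (fun e => ~~ (lt_code c e && lt_code e d)) codes.

Lemma lt_codeE (U V : subvariety R) : (U < V)%O = lt_code (code U) (code V).
Proof. by rewrite lt_neqAle eq_sym -(inj_eq code_inj) le_codeE. Qed.

(** Every subvariety has its code in [codes] and every such code is realized, so the search for an
    intermediate subvariety is finite. *)
Lemma covers_codeE (U V : subvariety R) :
  covers U V <-> covers_code (code U) (code V).
Proof.
split=> [[UV nW]|/andP[UV /allP nW]].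
  rewrite /covers_code -lt_codeE UV; apply/allP => c /code_surj[W <-].
  by rewrite -!lt_codeE; exact: nW.
split; first by rewrite lt_codeE.
by move=> W; rewrite !lt_codeE; apply: nW; exact: code_mem.
Qed.

Definition code_pair (UV : subvariety R * subvariety R) :=
  (code UV.1, code UV.2).

Lemma code_pair_inj : injective code_pair.
Proof.
move=> [A B] [C D] E.
by congr pair; apply: code_inj; [exact: (congr1 fst E)|exact: (congr1 snd E)].
Qed.

(** The bijection sends an element to its position in [s]. *)
Lemma card_setT_seq (T : eqType) (s : seq T) :
  uniq s -> (forall x, x \in s) -> ([set: T] #= `I_(size s))%card.
Proof.
move=> uniq_s mem_s; apply/card_set_bijP; exists (index^~ s); split.
- by move=> x _; rewrite /= index_mem.
- by move=> x y _ _; apply: index_inj.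
- move=> i /= lt_i_s; case: s => [//|x0 s] in uniq_s mem_s lt_i_s *.
  by exists (nth x0 (x0 :: s) i); rewrite // index_uniq.
Qed.

Theorem theorem2p7 :
  [/\ left_distributive (@Order.meet _ (subvariety R)) (@Order.join _ (subvariety R)),
      ([set: subvariety R] #= `I_10)%card,
      uniq [:: V_T; V_L2; V_N2; V_T2; V_L2N2; V_L2T2; V_N2T2; V_L2N2T2; V_S58; V_R],
      (forall V : subvariety R,
         V \in [:: V_T; V_L2; V_N2; V_T2; V_L2N2; V_L2T2; V_N2T2; V_L2N2T2;
                   V_S58; V_R]) &
      (forall A B : subvariety R,
         covers B A <->
         (A, B) \in [:: (V_T, V_L2); (V_T, V_N2); (V_T, V_T2);
                        (V_L2, V_L2N2); (V_L2, V_L2T2);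
                        (V_N2, V_L2N2); (V_N2, V_N2T2);
                        (V_T2, V_L2T2); (V_T2, V_N2T2);
                        (V_L2N2, V_L2N2T2); (V_L2T2, V_L2N2T2);
                        (V_N2T2, V_L2N2T2);
                        (V_L2T2, V_S58);
                        (V_S58, V_R); (V_L2N2T2, V_R)])].
Proof.
split.
- move=> U V W; apply: code_inj; rewrite !(code_meet, code_join).
  by rewrite /meet_code /join_code /= !andb_orl.
- exact: (card_setT_seq subvarieties_uniq subvarieties_all).
- exact: subvarieties_uniq.
- exact: subvarieties_all.
- move=> A B; rewrite covers_codeE -(mem_map code_pair_inj).
  rewrite /= /code_pair /= !codeE.
  (* All pairs of quadruples are evaluated; those outside [codes] contradict [code_mem]. *)
  by case: (code A) (code B) (code_mem A) (code_mem B) =>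
    [[[[] []] []] []] [[[[] []] []] []].
Qed.
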